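(* Let $(X,\tau)$ be a non-trivial real Hausdorff locally convex space such that for every proper convex $\tau$-lower semicontinuous function $f:X\to\overline{\mathbb{R}}$ one has $\operatorname{Graph}\partial f\ne\emptyset$. Then for every nonempty closed convex bounded $C\subset X$ the set of support functionals of $C$ is weak-star dense in $X^*$.
   Context: $X^*$ is the topological dual of $X$ and $\langle x,x^*\rangle:=x^*(x)$. A function $f:X\to\overline{\mathbb{R}}$ is proper if $\{x\mid f(x)<\infty\}$ is nonempty and $f$ never takes the value $-\infty$. The convex subdifferential $\partial f:X\rightrightarrows X^*$ is defined by: $x^*\in\partial f(x)$ iff $f(x)$ is finite and $f(y)\ge f(x)+\langle y-x,x^*\rangle$ for all $y\in X$; $\operatorname{Graph}\partial f=\{(x,x^* )\mid x^*\in\partial f(x)\}$. For $C\subset X$, the normal cone is $N_C(a)=\{a^*\in X^*\mid \langle y-a,a^*\rangle\le 0\ \forall y\in C\}$ if $a\in C$, $N_C(a)=\emptyset$ if $a\notin C$. The support functionals of $C$ are the elements of the range $R(N_C)=\bigcup_{a\in C}N_C(a)$, i.e. the functionals $n^*\in X^*$ that attain their supremum over $C$ at a point of $C$. *)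

(* Defs.v *)
From HB Require Import structures.
From mathcomp Require Import all_boot all_order all_algebra.
From mathcomp Require Import all_classical all_reals all_analysis.

Set Implicit Arguments.
Unset Strict Implicit.
Unset Printing Implicit Defensive.

Import Order.TTheory GRing.Theory Num.Theory.
Import numFieldTopology.Exports.

Local Open Scope classical_set_scope.
Local Open Scope ring_scope.

Record continuous_dual (R : realType) (X : tvsType R) := ContinuousDual {
  dual_fun :> {scalar X} ;
  dual_continuous : continuous (dual_fun : X -> R)
}.

HB.instance Definition _ (R : realType) (X : tvsType R) :=
  gen_eqMixin (continuous_dual X).
HB.instance Definition _ (R : realType) (X : tvsType R) :=
  gen_choiceMixin (continuous_dual X).

(* The canonical topology on [continuous_dual X] is the weak-star one: the
   topology of pointwise convergence, pulled back along the inclusion of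
   [continuous_dual X] in [X -> R]. *)
HB.instance Definition _ (R : realType) (X : tvsType R) :=
  Topological.copy (continuous_dual X)
    (initial_topology
       (fun f : continuous_dual X => (f : X -> R) : {ptws X -> R})).

(* The library's [bounded_set] needs a norm; this is boundedness in the sense
   of von Neumann. *)
Definition tvs_bounded (R : realType) (X : tvsType R) (C : set X) :=
  forall V : set X, nbhs (0 : X) V ->
    exists2 s : R, 0 < s & forall t : R, s < t -> C `<=` [set t *: v | v in V].

Section extended_real_functions.
Context (R : realType) (X : tvsType R).
Implicit Types f : X -> \bar R.
Local Open Scope ereal_scope.

Definition proper_efun f := (exists x, f x < +oo) /\ forall x, f x <> -oo.

(* Only points with [f x < +oo] are tested, so that [+oo + -oo] never occurs. *)
Definition convex_efun f := forall (t : {i01 R}) (x y : X),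
  f x < +oo -> f y < +oo ->
  f (t%:num *: x + (1 - t%:num) *: y)%R
    <= t%:num%:E * f x + (1 - t%:num)%:E * f y.

Definition subdifferential f (x : X) : set (continuous_dual X) :=
  [set x' : continuous_dual X | f x \is a fin_num /\
     forall y, f x + (x' (y - x)%R)%:E <= f y].

Definition graph_subdifferential f : set (X * continuous_dual X) :=
  [set p : X * continuous_dual X | subdifferential f p.1 p.2].

End extended_real_functions.

Definition normal_cone (R : realType) (X : tvsType R) (C : set X) (a : X) :
    set (continuous_dual X) :=
  [set a' : continuous_dual X | C a /\ forall y, C y -> a' (y - a) <= 0].

Definition support_functionals (R : realType) (X : tvsType R) (C : set X) :
    set (continuous_dual X) :=
  \bigcup_(a in C) normal_cone C a.

(* Main.v *)
Require Import Defs.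
From HB Require Import structures.
From mathcomp Require Import all_boot all_order all_algebra.
From mathcomp Require Import all_classical all_reals all_analysis.
From mathcomp Require Import lra.

Set Implicit Arguments.
Unset Strict Implicit.
Unset Printing Implicit Defensive.

Import Order.TTheory GRing.Theory Num.Theory.
Import numFieldTopology.Exports.
Import numFieldNormedType.Exports.

Local Open Scope classical_set_scope.
Local Open Scope ring_scope.

(** Fix a continuous functional [g]. A basic weak-star neighbourhood of [g] is
    given by finitely many vectors [x_1, ..., x_n] and a tolerance [e > 0]
    ([weak_star_nbhs]). Let [T : R^n -> X] be the map sending [v] to
    [v_1 x_1 + ... + v_n x_n], and consider
      [f x = inf { g (T v) + e |v| : x - T v \in C }],
    the infimal convolution of the indicator function of [C] with (the image
    under [T] of) the penalty [v |-> g (T v) + e |v|]. That penalty is the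
    support function of the set of linear forms on [R^n] at distance at most [e]
    from [g \o T]. As a subgradient of an infimal convolution, at a point where
    the infimum is attained, is a subgradient of both terms, a subgradient of
    [f] is a normal to [C] lying in the prescribed neighbourhood of [g].

    The hypothesis on [X] produces a subgradient [h] of [f] at some [x] once [f]
    is known to be proper, convex and lower semicontinuous. The last property,
    and the attainment of the infimum, both follow from one fact: the set [E] of
    the pairs [(x, r)] with [g (T v) + e |v| <= r] for some [v] such that
    [x - T v \in C] is closed ([penalized_epi_closed]). Boundedness of [C]
    enters there: [g] is bounded above on [C] by some [M], and then [(x, r)] in
    [E] forces [e |v| <= r - g x + M], so that near a given [(x, r)] only the
    vectors [v] of a compact ball of [R^n] matter. A closed upward set is the
    epigraph of the infimum of its vertical sections ([epi_fun_leP]).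

    Finally let [a] attain the infimum defining [f x] and put [c0 = x - T a].
    Testing the subgradient inequality at [c + T a], [c \in C], gives
    [h (c - c0) <= 0], i.e. [h] is normal to [C] at [c0]; testing it at
    [c0 + T (a + v)] gives [h (T v) <= g (T v) + e |v|]
    ([support_functional_near]). Taking for [v] the unit vectors and their
    opposites, [|h x_i - g x_i| <= e] for all [i]. *)

(** * Functions given by a closed epigraph *)

Section epigraph.
Context (R : realType) (X : tvsType R) (E : set (X * R)).

Definition epi_fun (x : X) : \bar R :=
  ereal_inf [set r%:E | r in [set r | E (x, r)]].

Hypothesis E_closed : closed E.
Hypothesis E_up : forall x r r', r <= r' -> E (x, r) -> E (x, r').

(** Each vertical section of [E] is closed, so it contains its infimum when the
    latter is finite; this is where attainment of infima comes from. *)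
Lemma epi_fun_leP x r : (epi_fun x <= r%:E)%E <-> E (x, r).
Proof.
split=> [fxr|Exr]; last by apply: ereal_inf_lbound; exists r.
have Er e : 0 < e -> E (x, r + e).
  move=> e0; have /ereal_inf_lt [_ [r' Er' <-]] : (epi_fun x < (r + e)%:E)%E.
    by rewrite (le_lt_trans fxr)// lte_fin ltrDl.
  by rewrite lte_fin => /ltW /E_up; apply.
have cvgE : (x, r + e) @[e --> 0^'+] --> (x, r).
  apply: (@cvg_pair _ _ _ _ (nbhs x) (nbhs r)); first exact: cvg_cst.
  apply: cvg_at_right_filter; rewrite -[X in _ --> X]addr0.
  by apply: cvgD; [exact: cvg_cst|exact: cvg_id].
apply: (closed_cvg E E_closed _ (x, r) cvgE).
by near=> e; apply: Er; near: e; exact: nbhs_right_gt.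
Unshelve. all: by end_near. Qed.

Lemma epi_fun_lsc : lower_semicontinuous epi_fun.
Proof.
apply/lower_semicontinuousP => a.
have -> : [set x | (a%:E < epi_fun x)%E] = (fun x => (x, a)) @^-1` (~` E).
  apply/seteqP; split => x /=.
    by move=> + /epi_fun_leP; rewrite leNgt => ->.
  by rewrite ltNge => nE; apply/negP => /epi_fun_leP.
apply: open_comp; last exact: closed_openC.
move=> x _; apply: (@cvg_pair _ _ _ _ (nbhs x) (nbhs a)); first exact: cvg_id.
exact: cvg_cst.
Qed.

Lemma epi_fun_proper : E !=set0 ->
  (forall x, exists m, forall r, E (x, r) -> m <= r) -> proper_efun epi_fun.
Proof.
move=> [[x r] Exr] Elb; split.
  by exists x; rewrite (le_lt_trans _ (ltry r))//; apply/epi_fun_leP.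
move=> y fy; have [m Em] := Elb y.
have /epi_fun_leP/Em : (epi_fun y <= (m - 1)%:E)%E by rewrite fy leNye.
by rewrite lerDl oppr_ge0 ler10.
Qed.

Lemma epi_fun_convex : proper_efun epi_fun ->
  (forall (t : {i01 R}) x y r s, E (x, r) -> E (y, s) ->
    E (t%:num *: x + (1 - t%:num) *: y, t%:num * r + (1 - t%:num) * s)) ->
  convex_efun epi_fun.
Proof.
move=> [_ fNy] Ecvx t x y.
case fx : (epi_fun x) => [r| |]//; last by have := fNy x.
case fy : (epi_fun y) => [s| |]//; last by have := fNy y.
move=> _ _; rewrite -!EFinM -EFinD; apply/epi_fun_leP.
by apply: Ecvx; apply/epi_fun_leP; rewrite ?fx ?fy.
Qed.

End epigraph.

(** * Bounded sets and penalized translates of a convex set *)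

Lemma tvs_bounded_dual (R : realType) (X : tvsType R) (C : set X)
    (g : continuous_dual X) : tvs_bounded C ->
  exists M, forall c, C c -> g c <= M.
Proof.
move=> /(_ [set v | g v < 1]) [].
  have := @dual_continuous _ _ g 0 [set r | r < 1].
  by rewrite /= linear0; apply; exact: lt_nbhsl.
move=> s s0 /(_ (s + 1)); rewrite ltrDl => /(_ ltr01) Cs; exists (s + 1) => c.
move=> /Cs [v /= gv <-]; rewrite linearZ/= ger_pMr ?ltW//.
by rewrite addr_gt0.
Qed.

Section penalized_translates.
Context (R : realType) (X : tvsType R) (n : nat).
Variables (C : set X) (g : continuous_dual X) (e : R).
Variable T : {linear 'rV[R]_n -> X}.

Definition penalty a := g (T a) + e * `|a|.

(** When this set is closed, it is the epigraph of the infimal convolution of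
    the indicator function of [C] with the image under [T] of the penalty. It is
    described by a witness [a]
    rather than by an infimum, so that a point of it carries the decomposition
    [p.1 = c + T a] with [c \in C]. *)
Definition penalized_epi : set (X * R) :=
  [set p | exists2 a, C (p.1 - T a) & penalty a <= p.2].

Lemma penalty_convex (t : {i01 R}) a b : 0 <= e ->
  penalty (t%:num *: a + (1 - t%:num) *: b) <=
  t%:num * penalty a + (1 - t%:num) * penalty b.
Proof.
move=> e0; rewrite /penalty !linearD !linearZ/=.
have t0 : 0 <= t%:num by [].
have t1 : 0 <= 1 - t%:num by rewrite subr_ge0.
have : e * `|t%:num *: a + (1 - t%:num) *: b| <=
       e * (t%:num * `|a| + (1 - t%:num) * `|b|).
  rewrite ler_wpM2l// (le_trans (ler_normD _ _))// !normrZ.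
  by rewrite (ger0_norm t0) (ger0_norm t1).
by lra.
Qed.

Lemma penalized_epi_up x r s :
  r <= s -> penalized_epi (x, r) -> penalized_epi (x, s).
Proof. by move=> rs [a /= Ca ar]; exists a => //=; exact: le_trans rs. Qed.

Lemma penalized_epi_convex : convex_set C -> 0 <= e ->
  forall (t : {i01 R}) x y r s, penalized_epi (x, r) -> penalized_epi (y, s) ->
  penalized_epi (t%:num *: x + (1 - t%:num) *: y,
                 t%:num * r + (1 - t%:num) * s).
Proof.
move=> Ccvx e0 t x y r s [a /= Ca ar] [b /= Cb bs].
exists (t%:num *: a + (1 - t%:num) *: b) => /=.
  have /set_mem := Ccvx _ _ t (mem_set Ca) (mem_set Cb).
  rewrite [X in C X -> _](_ : _ =
    t%:num *: (x - T a) + (1 - t%:num) *: (y - T b))//.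
  rewrite [T (_ + _)]linearD [T (_ *: a)]linearZ [T (_ *: b)]linearZ /=.
  by rewrite !scalerBr opprD addrACA.
rewrite (le_trans (penalty_convex _ _ _ e0))// lerD// ler_wpM2l//.
Qed.

Hypotheses (e_gt0 : 0 < e) (M : R) (C_le : forall c, C c -> g c <= M).

(** Writing [x = c + T a] with [c \in C], the linear part of the penalty is
    [g x - g c >= g x - M]; the rest of the penalty, [e * `|a|], is thus at most
    [r - (g x - M)]. *)
Lemma penalty_bound x a r : C (x - T a) -> penalty a <= r ->
  e * `|a| <= r - g x + M.
Proof. by move=> /C_le; rewrite linearB/= /penalty; lra. Qed.

Lemma penalized_epi_lb x r : penalized_epi (x, r) -> g x - M <= r.
Proof.
move=> [a /= Ca /(penalty_bound Ca)].
by have := mulr_ge0 (ltW e_gt0) (normr_ge0 a); lra.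
Qed.

Hypotheses (C_closed : closed C) (T_continuous : continuous T).

Lemma translate_continuous :
  continuous (fun z : 'rV[R]_n * (X * R) => z.2.1 - T z.1).
Proof.
move=> [a [x r]]; apply: (@continuous_comp _ _ _
  (fun z : 'rV[R]_n * (X * R) => (z.2.1, T z.1)) (fun z : X * X => z.1 - z.2)).
  apply: (@cvg_pair _ _ _ _ (nbhs x) (nbhs (T a))) => /=.
    by apply: (cvg_comp snd fst cvg_snd); exact: cvg_fst.
  by apply: (cvg_comp fst T cvg_fst); exact: T_continuous.
exact: sub_continuous.
Qed.

Lemma excess_continuous :
  continuous (fun z : 'rV[R]_n * (X * R) => penalty z.1 - z.2.2).
Proof.
move=> [a [x r]]; apply: cvgB; last first.
  by apply: (cvg_comp snd snd cvg_snd); exact: cvg_snd.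
apply: cvgD.
  apply: (cvg_comp fst (fun a => g (T a)) cvg_fst).
  by apply: continuous_comp; [exact: T_continuous|exact: dual_continuous].
apply: cvgMl_tmp; apply: (cvg_comp fst Num.norm cvg_fst).
exact: norm_continuous.
Qed.

(** [penalized_epi] is the projection along ['rV_n] of a closed set of triples
    [(a, x, r)], and a projection along a compact space is closed. The ball [K]
    below supplies the compactness: by [penalty_bound], every witness [a] for a
    point close to [(x, r)] lies in [K]. *)
Lemma penalized_epi_closed : closed penalized_epi.
Proof.
rewrite -[penalized_epi]setCK; apply: open_closedC.
rewrite openE => -[x r] /= nxr.
(* The summand [1] leaves room for [(x, r)] to vary. *)
pose B := (r - g x + M + 1) / e.
pose K := [set a : 'rV[R]_n | `|a| <= B].
have K_compact : compact K.
  apply: bounded_closed_compact.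
    exists B; split; first exact: num_real.
    by move=> A BA a /= aB; exact: le_trans aB (ltW BA).
  apply: (@preimage_closed _ _ (fun a : 'rV[R]_n => `|a|) [set y | y <= B]).
    by move=> a _; exact: norm_continuous.
  exact: closed_le.
pose P (q : X * R) a := ~ (C (q.1 - T a) /\ penalty a <= q.2).
have nearK : \forall q \near (x, r), K `<=` P q.
  apply: (iffLR (compact_near_coveringP K) K_compact _ (nbhs (x, r)) P) => a Ka.
  pose FF := nbhs_filter (a, (x, r)).
  (* At [(a, (x, r))] one of the two closed conditions fails, hence it fails
     in a neighbourhood. *)
  suff : nbhs (a, (x, r)) [set z | P z.2 z.1] by [].
  have [Ca|nCa] := pselect (C (x - T a)).
    have ra : 0 < penalty a - r.
      by rewrite subr_gt0 ltNge; apply/negP => ar; apply: nxr; exists a.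
    have far_above :=
      cvgr_gt (FF := FF) _ (@excess_continuous (a, (x, r))) _ ra.
    apply: (@filterS _ _ FF _ _ _ far_above) => -[b q] /=.
    by rewrite subr_gt0 ltNge => /negP bq [].
  have outside : nbhs (x - T a) (~` C).
    by apply: open_nbhs_nbhs; split=> //; exact: closed_openC.
  have near_outside := @translate_continuous (a, (x, r)) _ outside.
  by apply: (@filterS _ _ FF _ _ _ near_outside) => -[b q] /= nCb [].
have far : \forall q \near (x, r), q.2 - g q.1 + M < B * e.
  pose FF := nbhs_filter (x, r).
  apply: (cvgr_lt (FF := FF) (f := fun q => q.2 - g q.1 + M) (r - g x + M));
    last by rewrite /B divfK ?gt_eqF// ltrDl ltr01.
  apply: cvgD; last exact: cvg_cst.
  apply: cvgB; first exact: cvg_snd.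
  by apply: (cvg_comp fst g cvg_fst); exact: dual_continuous.
apply: filterS2 far nearK => q qB qP [a Ca aq].
apply: (qP a) => //=.
rewrite /K/= -(ler_pM2r e_gt0) mulrC.
exact: le_trans (penalty_bound Ca aq) (ltW qB).
Qed.

End penalized_translates.

(** * Linear combinations of finitely many vectors *)

Definition lincomb (R : realType) (X : tvsType R) (s : seq X)
    (v : 'rV[R]_(size s)) : X :=
  \sum_(i < size s) v 0 i *: s`_i.
Arguments lincomb {R X} s v.

Section lincomb.
Context (R : realType) (X : tvsType R) (s : seq X).

Lemma lincomb_is_linear : linear (lincomb s).
Proof.
move=> k u v; rewrite /lincomb scaler_sumr -big_split /=; apply: eq_bigr => i _.
by rewrite !mxE scalerDl scalerA.
Qed.

HB.instance Definition _ :=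
  GRing.isLinear.Build R 'rV[R]_(size s) X *:%R (lincomb s) lincomb_is_linear.

Lemma lincomb_continuous : continuous (lincomb s).
Proof.
apply: continuous_big => [|i _ v]; first exact: add_continuous.
apply: (@continuous_comp _ _ _ (fun v : 'rV[R]_(size s) => (v 0 i : R^o, s`_i))
  (fun z : R^o * X => z.1 *: z.2)); last exact: scale_continuous.
apply: (@cvg_pair _ _ _ (nbhs v) (nbhs (v 0 i : R^o)) (nbhs s`_i)).
  exact: coord_continuous.
exact: cvg_cst.
Qed.

Lemma lincomb_delta i : lincomb s (delta_mx 0 i) = s`_i.
Proof.
rewrite /lincomb (bigD1 i)//= mxE !eqxx scale1r big1 ?addr0// => j ji.
by rewrite mxE (negbTE ji) andbF scale0r.
Qed.

End lincomb.

Lemma normr_delta_mx_le1 (R : realType) n (i : 'I_n) :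
  `|delta_mx 0 i : 'rV[R]_n| <= 1.
Proof.
rewrite /Num.norm/= mx_normrE; apply/bigmax_leP; split=> // -[j k] _ /=.
by rewrite mxE; case: (_ && _); rewrite ?normr1 ?normr0.
Qed.

(** * Weak-star neighbourhoods *)

(** The sets [B (s, e)] generate a filter [F]; by the universal property of the
    initial and product topologies, that [F] converges to [g] can be tested one
    vector [x] at a time, which avoids handling finite intersections of
    subbasic open sets. *)
Lemma weak_star_nbhs (R : realType) (X : tvsType R) (g : continuous_dual X)
    (O : set (continuous_dual X)) : nbhs g O ->
  exists s : seq X, exists2 e : R, 0 < e &
    forall h : continuous_dual X,
      (forall x, x \in s -> `|h x - g x| <= e) -> O h.
Proof.
pose B (p : seq X * R) := [set h : continuous_dual X |
  forall x, x \in p.1 -> `|h x - g x| <= p.2].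
pose F := filter_from [set p : seq X * R | 0 < p.2] B.
have FF : Filter F.
  apply: filter_from_filter; first by exists ([::], 1) => /=.
  move=> [s d] [t e] /= d0 e0; exists (s ++ t, Num.min d e) => /=.
    by rewrite lt_min d0.
  move=> h /= Bh; split=> x /= xs; have := Bh x;
    by rewrite mem_cat xs ?orbT => /(_ isT); rewrite le_min => /andP[].
suff Fg : F --> g by move=> /Fg [[s e] /= e0 BO]; exists s, e.
pose to_ptws (h : continuous_dual X) := (h : X -> R) : {ptws X -> R}.
have F_ptws : to_ptws @ F --> to_ptws g.
  apply/cvg_sup => x A /= [_ [[W W_open <-] Wgx] WA].
  have /nbhs_ballP [d /= d0 dW] : nbhs (g x) W by exact: open_nbhs_nbhs.
  exists ([:: x], d / 2) => [|h /= Bh] /=; first by rewrite divr_gt0.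
  apply: WA => /=; apply: dW; rewrite /ball/= distrC.
  by rewrite (le_lt_trans (Bh x _)) ?inE// gtr_pMr// invf_lt1 ?ltr1n.
move=> A /= [_ [[W W_open <-] Wg] WA].
exact: (filterS WA (F_ptws W (open_nbhs_nbhs (conj W_open Wg)))).
Qed.

(** * Support functionals from subgradients *)

Section support_functional.
Context (R : realType) (X : tvsType R).
Hypothesis X_subdiff : forall f : X -> \bar R,
  proper_efun f -> convex_efun f -> lower_semicontinuous f ->
  graph_subdifferential f !=set0.
Variable C : set X.
Hypotheses (C_nonempty : C !=set0) (C_closed : closed C).
Hypotheses (C_convex : convex_set C) (C_bounded : tvs_bounded C).

(** A support functional whose pullback by [T] is [e]-close to that of [g]: a
    subgradient of the penalized infimum defined by [penalized_epi]. *)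
Lemma support_functional_near (g : continuous_dual X) n
    (T : {linear 'rV[R]_n -> X}) (e : R) : continuous T -> 0 < e ->
  exists2 h, support_functionals C h & forall v, h (T v) <= g (T v) + e * `|v|.
Proof.
move=> T_continuous e0.
have [M C_le] := tvs_bounded_dual g C_bounded.
pose E := penalized_epi C g e T.
have E_closed : closed E by exact: penalized_epi_closed C_le _ _.
have E_up : forall x r r', r <= r' -> E (x, r) -> E (x, r').
  by move=> x r r'; exact: penalized_epi_up.
have E_in c v : C c -> E (c + T v, penalty g e T v).
  by move=> Cc; exists v => //=; rewrite addrK.
have f_proper : proper_efun (epi_fun E).
  apply: epi_fun_proper => //.
    have [c Cc] := C_nonempty.
    by exists (c + T 0, penalty g e T 0); exact: E_in.
  by move=> x; exists (g x - M) => r; exact: penalized_epi_lb.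
have [||[x h] [/= /fineK fx sub]] := X_subdiff f_proper.
- apply: epi_fun_convex => // t x y r s.
  by apply: penalized_epi_convex => //; exact: ltW.
- exact: epi_fun_lsc.
(* The infimum defining [epi_fun E x] is attained, at [a]. *)
have [a /= Ca ar] : E (x, fine (epi_fun E x)).
  by apply/epi_fun_leP => //; rewrite fx.
have subgradient_le c v : C c ->
    penalty g e T a + h (c + T v - x) <= penalty g e T v.
  move=> /E_in => /(_ v) /(epi_fun_leP E_closed E_up) Ecv.
  have := le_trans (sub (c + T v)) Ecv.
  by rewrite -fx -EFinD lee_fin; apply: le_trans; rewrite lerD2r.
exists h.
  exists (x - T a) => //; split=> // y Cy.
  have := subgradient_le y a Cy; rewrite gerDl.
  by rewrite opprB addrA addrAC.
move=> v; have := subgradient_le _ (a + v) Ca.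
have -> : x - T a + T (a + v) - x = T v.
  by rewrite [T (a + v)]linearD addrA subrK addrAC subrr add0r.
have := ler_wpM2l (ltW e0) (ler_normD a v).
by rewrite /penalty !linearD/=; lra.
Qed.

End support_functional.

Theorem corollary11 (R : realType) (X : tvsType R)
    (X_nontrivial : exists x : X, x != 0)
    (X_hausdorff : hausdorff_space X)
    (X_subdiff : forall f : X -> \bar R,
       proper_efun f -> convex_efun f -> lower_semicontinuous f ->
       graph_subdifferential f !=set0)
    (C : set X) (C_nonempty : C !=set0) (C_closed : closed C)
    (C_convex : convex_set C) (C_bounded : tvs_bounded C) :
  dense (support_functionals C).
Proof.
move=> O [g Og] O_open.
have [s [e e0 sO]] := weak_star_nbhs (open_nbhs_nbhs (conj O_open Og)).
have [h Ch hg] := support_functional_near X_subdiff C_nonempty C_closed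
  C_convex C_bounded g (@lincomb_continuous _ _ s) e0.
exists h; split=> //; apply: sO => _ /(nthP 0) [i si <-].
pose d : 'rV[R]_(size s) := delta_mx 0 (Ordinal si).
have Td : lincomb s d = s`_i by exact: lincomb_delta.
have ed : e * `|d| <= e by rewrite ger_pMr// normr_delta_mx_le1.
have := hg d; have := hg (- d).
rewrite /= normrN [lincomb s _]linearN /= Td !linearN => hN hP.
by rewrite ler_norml; apply/andP; split; lra.
Qed.
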